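(* Let $Y = \mathbb{R}^m$, let $K = \mathbb{R}^m_+$ be the nonnegative orthant, and let $\mathcal{T} \subset \mathbb{R}^m_+$ be the set of vectors with positive coordinates. Let the set $Q$ be closed, let the functions $f$ and $\|\varphi(\cdot)\|$ be lower semicontinuous on $Q$, and suppose there exists $\gamma > 0$ such that either $s_n \ge \gamma$ for all $n \in \mathbb{N}$ or $s_n \ge \gamma / \|\varphi(x_n)\|$ for all $n \in \mathbb{N}$. Consider the Global Exact Penalty Method with Adaptive Penalty Updates described in the context, where each penalized problem encountered is assumed to have a globally optimal solution. Then the method either terminates after a finite number of iterations by finding a globally optimal solution of $(\mathcal{P})$, or generates an infinite sequence $\{x_n\}$ such that $\varphi(x_n) \to 0$ as $n \to \infty$ and all limit points of $\{x_n\}$ (if they exist) are globally optimal solutions of $(\mathcal{P})$. Moreover, in the latter case, if the sequence of penalty parameters $\{\tau_n\}$ is bounded and there exists a limit point of the sequence $\{x_n\}$, then the penalty function $\Phi_{\tau}$ is globally exact, and the sequence $\{\tau_n\}$ converges to a point $\tau_*$ such that any $\tau$ with $\tau - \tau_* \in K^*_+$ (i.e. all coordinates of $\tau - \tau_*$ are positive) is a global exact penalty parameter.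
   Context: Setting. $(X,d)$ is a metric space, $M, Q \subseteq X$ satisfy $M \cap Q \neq \emptyset$, and $f \colon X \to \mathbb{R} \cup \{+\infty\}$. Problem $(\mathcal{P})$: minimize $f(x)$ subject to $x \in M \cap Q$. It is assumed that $(\mathcal{P})$ has a globally optimal solution and that its optimal value $f_*$ is finite. $Y = \mathbb{R}^m$ is equipped with a norm $\|\cdot\|$, and $Y^*$ is identified with $\mathbb{R}^m$ through the standard inner product $\langle\cdot,\cdot\rangle$; thus $K = K^* = \mathbb{R}^m_+$ and $K^*_+ = \mathcal{T}$ is the set of vectors with positive coordinates. An improper element $\infty$ is added to $Y$, with $\|\infty\| = +\infty$. $\varphi \colon X \to K \cup \{\infty\}$ is a function such that $\varphi(x) = 0$ iff $x \in M$. For $\tau \in \mathcal{T}$, $\Phi_\tau(x) = f(x) + \langle \tau, \varphi(x)\rangle$, where $\langle \tau, \infty\rangle = +\infty$. Problem $(\mathcal{P}_\tau)$: minimize $\Phi_\tau(x)$ subject to $x \in Q$. Write $\tau \succeq_{K^*} \tau_*$ iff $\tau - \tau_* \in K^*$. Global exactness. $\Phi_\tau$ is globally exact if there is $\tau_* \in \mathcal{T}$ such that for all $\tau \in \mathcal{T}$ with $\tau \succeq_{K^*} \tau_*$ the set of globally optimal solutions of $(\mathcal{P})$ coincides with the set of globally optimal solutions of $(\mathcal{P}_\tau)$. Any such $\tau_*$ is called a (global) exact penalty parameter. A limit point of a sequence is the limit of some convergent subsequence. Global Exact Penalty Method with Adaptive Penalty Updates. Choose $\tau_1 \in \mathcal{T}$;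 set $n := 1$. Main step: let $x_n$ be a globally optimal solution of $(\mathcal{P}_{\tau_n})$. If $x_n$ is feasible for $(\mathcal{P})$ (i.e. $x_n \in M \cap Q$), stop. Otherwise choose a scaling coefficient $s_n > 0$, put $\tau_{n+1} = \tau_n + s_n \varphi(x_n)$, $n := n+1$, and repeat the main step. *)

(* Defs.v *)
From HB Require Import structures.
From mathcomp Require Import all_boot all_order all_algebra.
From mathcomp Require Import all_classical all_reals all_analysis.

Set Implicit Arguments.
Unset Strict Implicit.
Unset Printing Implicit Defensive.

Import Order.TTheory GRing.Theory Num.Theory.
Import numFieldNormedType.Exports.

Local Open Scope classical_set_scope.
Local Open Scope ring_scope.

(* An arbitrary norm on R^m, independent of the canonical (sup) norm that the
   library puts on row vectors. *)
Record is_norm (R : realType) (m : nat) (N : 'rV[R]_m -> R) : Prop := IsNorm {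
  norm_triangle : forall u v, N (u + v) <= N u + N v;
  norm_scale : forall (a : R) v, N (a *: v) = `|a| * N v;
  norm_definite : forall v, N v = 0 -> v = 0 }.

(* K = R^m_+, which is also K^* under the standard inner product. *)
Definition orthant (R : realType) (m : nat) : set 'rV[R]_m :=
  [set v | forall i, 0 <= v ord0 i].

(* The set T of admissible penalty parameters, which is also K^*_+. *)
Definition pos_orthant (R : realType) (m : nat) : set 'rV[R]_m :=
  [set v | forall i, 0 < v ord0 i].

(* R^m together with the improper element is option 'rV[R]_m; None is the
   improper element. *)
Definition enorm (R : realType) (m : nat) (N : 'rV[R]_m -> R)
    (y : option 'rV[R]_m) : \bar R :=
  if y is Some v then (N v)%:E else +oo%E.

Definition einner (R : realType) (m : nat) (tau : 'rV[R]_m)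
    (y : option 'rV[R]_m) : \bar R :=
  if y is Some v then (\sum_(i < m) tau ord0 i * v ord0 i)%:E else +oo%E.

Definition penalty_fun (R : realType) (m : nat) (X : Type) (f : X -> \bar R)
    (phi : X -> option 'rV[R]_m) (tau : 'rV[R]_m) (x : X) : \bar R :=
  (f x + einner tau (phi x))%E.

Definition global_solutions (R : realType) (X : Type) (F : X -> \bar R)
    (A : set X) : set X :=
  [set x | A x /\ forall y, A y -> (F x <= F y)%E].

Definition exact_penalty_parameter (R : realType) (m : nat) (X : Type)
    (f : X -> \bar R) (phi : X -> option 'rV[R]_m) (M Q : set X)
    (taus : 'rV[R]_m) : Prop :=
  pos_orthant taus /\
  forall tau, pos_orthant tau -> orthant (tau - taus) ->
    global_solutions f (M `&` Q) =
    global_solutions (penalty_fun f phi tau) Q.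

Definition globally_exact (R : realType) (m : nat) (X : Type)
    (f : X -> \bar R) (phi : X -> option 'rV[R]_m) (M Q : set X) : Prop :=
  exists taus, exact_penalty_parameter f phi M Q taus.

(* subspace Q carries the topology in which neighbourhoods of a point of Q are
   the relative ones and points outside Q are isolated, hence unconstrained. *)
Definition lower_semicontinuous_on (R : realType) (X : topologicalType)
    (Q : set X) (F : X -> \bar R) : Prop :=
  lower_semicontinuous (F : subspace Q -> \bar R).

Definition seq_limit_point (X : topologicalType) (u : nat -> X) (p : X) : Prop :=
  exists2 g : nat -> nat, increasing_seq g & u (g k) @[k --> \oo] --> p.

(* The method has not stopped before computing the iterate of index n. *)
Definition reached (X : Type) (A : set X) (x : nat -> X) (n : nat) : Prop :=
  forall k, (k < n)%N -> ~ A (x k).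

(* Iterates are indexed from 0, so tau 0 is the initial penalty parameter.  The
   sequences are total, but nothing is required of x n and tau n unless the
   iterate n is reached, nor of s n unless the method goes on after it.  In
   run_update the equality lives in option 'rV[R]_m, so phi (x n) is proper. *)
Record adaptive_run (R : realType) (m : nat) (X : Type)
    (f : X -> \bar R) (phi : X -> option 'rV[R]_m) (M Q : set X)
    (x : nat -> X) (tau : nat -> 'rV[R]_m) (s : nat -> R) : Prop :=
  AdaptiveRun {
    run_init : pos_orthant (tau 0%N);
    run_solution : forall n, reached (M `&` Q) x n ->
      global_solutions (penalty_fun f phi (tau n)) Q (x n);
    run_scale : forall n, reached (M `&` Q) x n.+1 -> 0 < s n;
    run_update : forall n, reached (M `&` Q) x n.+1 ->
      Some (tau n.+1) = omap (fun v => tau n + s n *: v) (phi (x n)) }.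

(* Main.v *)
Require Import Defs.
From HB Require Import structures.
From mathcomp Require Import all_boot all_order all_algebra.
From mathcomp Require Import all_classical all_reals all_analysis.
From mathcomp Require Import lra.

Set Implicit Arguments.
Unset Strict Implicit.
Unset Printing Implicit Defensive.

Import Order.TTheory GRing.Theory Num.Theory.
Import numFieldNormedType.Exports.

Local Open Scope classical_set_scope.
Local Open Scope ring_scope.

(** Write [v_n] for the (proper) value of [phi] at the iterate [x_n], and [f_*]
    for the optimal value of the constrained problem.

    An optimal point of the constrained problem is a competitor in every
    penalized problem and pays no penalty there, so
    [f (x_n) + <tau_n, v_n> <= f_*], and in particular [f (x_n) <= f_*]. A
    feasible iterate is therefore optimal, which settles finite termination.

    Suppose that no iterate is feasible. The objective may be unbounded below on
    [Q], but the first iterate minimizes the penalty function for [tau_0], so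
    [f (x_n) + <tau_0, v_n>] is bounded below; subtracting, the quantity
    [<tau_n - tau_0, v_n>] is bounded above ([penalty_increment_bounded]). This
    is a sum of nonnegative terms, so each term is bounded above. Fix a
    coordinate [i]; the multipliers [tau_n^i] are nondecreasing with increments
    [s_n v_n^i]. If they are unbounded, the bound on the product forces [v_n^i]
    to vanish. If they are bounded they converge, and [s_n v_n^i] vanishes. Both
    step rules imply [gamma <= s_n max(1, N v_n)], so in either case [v_n^i] is
    eventually at most [e * max(1, N v_n)] ([adaptive_coord_vanish]). Summing
    over the coordinates gives the same for [N v_n], and for [e < 1] this is
    only possible if [N v_n <= e] ([adaptive_norm_vanish]).

    At a limit point of the iterates, lower semicontinuity turns [N v_n -> 0]
    into feasibility and [f (x_n) <= f_*] into optimality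
    ([seq_limit_point_lsc]).

    Finally, let [tau_n] be bounded. Being coordinatewise nondecreasing, it
    converges to some [tau_*] from below ([bounded_nondecreasing_cvg]). For [y]
    in [Q], the penalty function for [tau_*] is at [y] at least the one for
    [tau_n], hence at least [f (x_n)] for every [n]; passing to a limit point by
    lower semicontinuity, it is at least [f_*]. Once the penalty function for
    [tau_*] is at least [f_*] on [Q], any parameter strictly above [tau_*] puts
    strictly more than [f_*] on every infeasible point of [Q], which is
    exactness ([exact_above]). *)

(** * Norms on row vectors *)

Lemma is_norm0 (R : realType) (m : nat) (N : 'rV[R]_m -> R) :
  is_norm N -> N 0 = 0.
Proof. by move=> nN; rewrite -(scale0r 0) (norm_scale nN) normr0 mul0r. Qed.

Lemma is_normN (R : realType) (m : nat) (N : 'rV[R]_m -> R) v :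
  is_norm N -> N (- v) = N v.
Proof. by move=> nN; rewrite -scaleN1r (norm_scale nN) normrN1 mul1r. Qed.

Lemma is_norm_ge0 (R : realType) (m : nat) (N : 'rV[R]_m -> R) v :
  is_norm N -> 0 <= N v.
Proof.
move=> nN; have := norm_triangle nN v (- v).
by rewrite subrr (is_norm0 nN) (is_normN _ nN); lra.
Qed.

Lemma norm_le_coord (R : realType) (m : nat) (N : 'rV[R]_m -> R) v :
  is_norm N -> N v <= \sum_(i < m) N (delta_mx ord0 i) * `|v ord0 i|.
Proof.
move=> nN; rewrite {1}(row_sum_delta v).
apply: (big_ind2 (fun a b => N a <= b)) => [|a b c d ab cd|i _].
- by rewrite (is_norm0 nN).
- by apply: le_trans (norm_triangle nN _ _) _; exact: lerD.
- by rewrite (norm_scale nN) mulrC.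
Qed.

Lemma norm_dist_le (R : realType) (m : nat) (N : 'rV[R]_m -> R) u v :
  is_norm N -> `|N u - N v| <= N (u - v).
Proof.
move=> nN; rewrite ler_norml.
have := norm_triangle nN (u - v) v; rewrite subrK.
have := norm_triangle nN (v - u) u; rewrite subrK -(opprB u v) (is_normN _ nN).
by move=> h1 h2; apply/andP; split; lra.
Qed.

Lemma norm_cvg_coord (R : realType) (m : nat) (N : 'rV[R]_m -> R) (T : Type)
    (F : set_system T) (FF : Filter F) (u : T -> 'rV[R]_m) (l : 'rV[R]_m) :
  is_norm N -> (forall i, u t ord0 i @[t --> F] --> l ord0 i) ->
  N (u t - l) @[t --> F] --> (0 : R).
Proof.
move=> nN ul.
apply: (@squeeze_cvgr _ _ _ _ (fun=> 0)
  (fun t => \sum_(i < m) N (delta_mx ord0 i) * `|(u t - l) ord0 i|)).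
- by apply: nearW => t; rewrite is_norm_ge0// norm_le_coord.
- exact: cvg_cst.
- rewrite [X in _ --> X](_ : 0 = \sum_(i < m) N (delta_mx ord0 i) * 0);
    last first.
    by rewrite big1// => i _; rewrite mulr0.
  apply: cvg_big => [|i _]; first exact: add_continuous.
  apply: cvgMl_tmp.
  rewrite -(@normr0 R R) -(subrr (l ord0 i)).
  under eq_fun do rewrite !mxE.
  by apply: cvg_norm; apply: cvgB => //; exact: cvg_cst.
Qed.

(** The topology on row vectors is the coordinatewise one, so continuity reduces
    to [norm_cvg_coord] and the Lipschitz bound [norm_dist_le]. *)
Lemma is_norm_continuous (R : realType) (m : nat) (N : 'rV[R]_m -> R) :
  is_norm N -> continuous N.
Proof.
move=> nN v.
have h := @norm_cvg_coord R m N _ (nbhs v) (nbhs_filter v) id v nN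
  (fun i => @coord_continuous R 1 m ord0 i v).
apply/(@cvgrPdist_le _ R^o _ (nbhs v)) => e e0.
apply: (@filterS _ _ (nbhs_filter v) _ _ _ (cvgr_le 0 h _ e0)) => t.
apply: le_trans.
by rewrite -(is_normN (t - v) nN) opprB; exact: norm_dist_le.
Qed.

(** The half of the equivalence of norms that needs compactness: [N] attains its
    minimum on the unit sphere of the sup norm, and this minimum is positive
    because [N] is definite. It is what turns a bound on [N (tau n)] into bounds
    on the coordinates. *)
Lemma coord_le_norm (R : realType) (m : nat) (N : 'rV[R]_m -> R) :
  is_norm N -> exists C : R, forall (v : 'rV[R]_m) i, `|v ord0 i| <= C * N v.
Proof.
move=> nN.
suff [C hC] : exists C : R, forall v : 'rV[R]_m, `|v| <= C * N v.
  exists C => v i; apply: le_trans (hC v).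
  rewrite [leRHS]mx_normrE.
  exact: (le_bigmax _ (fun ij => `|v ij.1 ij.2|) (ord0, i)).
pose S := [set v : 'rV[R]_m | `|v| = 1].
have normalized (v : 'rV[R]_m) : v != 0 -> S (`|v|^-1 *: v).
  by move=> v0; rewrite /S/= normrZ normfV normr_id mulVf// normr_eq0.
(* In dimension 0 the sphere is empty and has no minimizer. *)
have [[w Sw]|S0] := pselect (S !=set0); last first.
  exists 0 => v; have [->|v0] := eqVneq v 0; first by rewrite normr0 mul0r.
  by exfalso; apply: S0; exists (`|v|^-1 *: v); exact: normalized.
have cS : compact S.
  apply: bounded_closed_compact.
    by exists 1; split => // M M1 v /= ->; exact: ltW.
  apply: (@preimage_closed _ _ (fun v : 'rV[R]_m => `|v|) [set 1]).
    by move=> v _; exact: norm_continuous.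
  exact: closed_eq.
have cN : {within S, continuous N}.
  by apply: continuous_subspaceT; exact: is_norm_continuous.
have [c Sc cmin] := EVT_min_rV (ex_intro _ w Sw) cS cN.
have Nc0 : 0 < N c.
  rewrite lt_neqAle (is_norm_ge0 _ nN) andbT eq_sym.
  apply/eqP => /(norm_definite nN) c0.
  by move: Sc; rewrite c0 inE/= normr0 => /esym/eqP; rewrite oner_eq0.
exists (N c)^-1 => v; have [->|v0] := eqVneq v 0.
  by rewrite normr0 (is_norm0 nN) mulr0.
have := cmin _ (mem_set (normalized v v0)).
rewrite (norm_scale nN) normfV normr_id => h.
rewrite ler_pdivlMl// mulrC.
by move: h; rewrite ler_pdivlMl ?normr_gt0.
Qed.

(** * The penalized quantity vanishes *)

(** One coordinate of the update [tau n.+1 = tau n + s n *: v n]. Either [t]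
    stays bounded, so that it converges and its increments [s n * a n] vanish,
    or [t] is unbounded, and then the bound on [(t n - t 0) * a n] makes [a n]
    small. The weight [w n] is kept abstract because the same weight
    [max 1 (N (v n))] serves all coordinates. *)
Lemma adaptive_coord_vanish (R : realType) (t a s w : nat -> R) (C gamma : R) :
  0 < gamma -> (forall n, 0 <= a n) -> (forall n, 0 <= s n) ->
  (forall n, 1 <= w n) ->
  (forall n, t n.+1 = t n + s n * a n) ->
  (forall n, gamma <= s n * w n) ->
  (forall n, (t n - t 0%N) * a n <= C) ->
  forall e, 0 < e -> \forall n \near \oo, a n <= e * w n.
Proof.
move=> gamma0 a0 s0 w1 tS sw tC e e0.
have nd : nondecreasing_seq t.
  by apply/nondecreasing_seqP => n; rewrite tS lerDl mulr_ge0.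
have [bt|nbt] := pselect (has_ubound (range t)).
- have ct := nondecreasing_is_cvgn nd bt.
  have dt : t n.+1 - t n @[n --> \oo] --> (0 : R).
    rewrite -(subrr (limn t)); apply: cvgB => //.
    by rewrite (cvg_shiftS t).
  apply: filterS (cvgr_le 0 dt _ (mulr_gt0 gamma0 e0)) => n.
  rewrite tS addrAC subrr add0r => san.
  rewrite -(ler_pM2l gamma0) mulrA.
  have wn0 : 0 <= w n by rewrite (le_trans _ (w1 n)).
  apply: le_trans (ler_wpM2r wn0 san).
  by rewrite mulrAC ler_wpM2r.
- have [n0 tn0] : exists n0, `|C| / e < t n0 - t 0%N.
    apply: contrapT => h; apply: nbt; exists (t 0%N + `|C| / e) => _ [n _ <-].
    by rewrite -lerBlDl leNgt; apply/negP => tn; apply: h; exists n.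
  exists n0 => // n /= n0n.
  have d0 : 0 <= `|C| / e by rewrite divr_ge0// ltW.
  have tn : `|C| / e < t n - t 0%N.
    by apply: lt_le_trans tn0 _; rewrite lerD2r; exact: nd.
  suff ane : a n <= e.
    by apply: le_trans ane _; rewrite ler_peMr// ltW.
  rewrite leNgt; apply/negP => ean.
  have := tC n; apply/negP; rewrite -ltNge.
  apply: le_lt_trans (ler_norm C) _.
  have := ltr_pM d0 (ltW e0) tn ean.
  by rewrite divfK// gt_eqF.
Qed.

(** [einner t (Some v)] is [(inner t v)%:E] by conversion. *)
Definition inner (R : realType) (m : nat) (t v : 'rV[R]_m) : R :=
  \sum_(i < m) t ord0 i * v ord0 i.

(** The lower bound on [s n * max 1 (N (v n))] only makes the coordinates of
    [v n] small relative to [max 1 (N (v n))]. Summing them bounds [N (v n)] by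
    a small multiple of that same maximum, which rules out [1 <= N (v n)] and so
    leaves an absolute bound. *)
Lemma adaptive_norm_vanish (R : realType) (m : nat) (N : 'rV[R]_m -> R)
    (tau v : nat -> 'rV[R]_m) (s : nat -> R) (C gamma : R) :
  is_norm N -> 0 < gamma -> (forall n, orthant (v n)) -> (forall n, 0 <= s n) ->
  (forall n, tau n.+1 = tau n + s n *: v n) ->
  (forall n, gamma <= s n * Num.max 1 (N (v n))) ->
  (forall n, inner (tau n - tau 0%N) (v n) <= C) ->
  N (v n) @[n --> \oo] --> (0 : R).
Proof.
move=> nN gamma0 v0 s0 tauS sw tC.
have tau_nd n : orthant (tau n - tau 0%N).
  elim: n => [|n ih] i; first by rewrite subrr mxE.
  by rewrite tauS addrAC mxE addr_ge0// mxE mulr_ge0//; exact: v0.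
have w1 n : 1 <= Num.max 1 (N (v n)) by rewrite le_max lexx.
have coord e : 0 < e -> \forall n \near \oo, forall i,
    v n ord0 i <= e * Num.max 1 (N (v n)).
  move=> e0; apply: filter_forall => i.
  apply: (@adaptive_coord_vanish _ (fun n => tau n ord0 i)
    (fun n => v n ord0 i) s _ C gamma) => //.
  - by move=> n; exact: v0.
  - by move=> n; rewrite tauS !mxE.
  - move=> n; apply: le_trans (tC n).
    rewrite /inner (bigD1 i)//= !mxE lerDl sumr_ge0// => j _.
    by rewrite mulr_ge0//; [exact: tau_nd|exact: v0].
pose L := 1 + \sum_(i < m) N (delta_mx ord0 i).
have L0 : 0 < L.
  by rewrite ltr_pwDl// sumr_ge0// => i _; exact: is_norm_ge0.
apply/cvgr0Pnorm_le => e e0.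
(* A factor below 1 makes 1 <= N (v n) <= d * N (v n) impossible. *)
pose d := Num.min e 2^-1.
have d0 : 0 < d by rewrite lt_min e0 invr_gt0 ltr0n.
apply: filterS (coord _ (divr_gt0 d0 L0)) => n vn.
rewrite ger0_norm ?is_norm_ge0//.
have : N (v n) <= d * Num.max 1 (N (v n)).
  apply: le_trans (norm_le_coord _ nN) _.
  have h : \sum_(i < m) N (delta_mx ord0 i) * `|v n ord0 i| <=
     \sum_(i < m) N (delta_mx ord0 i) * (d / L * Num.max 1 (N (v n))).
    apply: ler_sum => i _; apply: ler_wpM2l; first exact: is_norm_ge0.
    by rewrite ger0_norm ?vn//; exact: v0.
  apply: le_trans h _; rewrite -mulr_suml mulrA ler_wpM2r//.
    by rewrite (le_trans _ (w1 n)).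
  by rewrite mulrCA ler_piMr ?(ltW d0)// ler_pdivrMr// mul1r /L lerDr ler01.
have [N1|N1] := leP 1 (N (v n)).
- move=> h; exfalso.
  have : d * N (v n) <= 2^-1 * N (v n).
    by rewrite ler_wpM2r ?is_norm_ge0// ge_min lexx orbT.
  lra.
- by rewrite mulr1 => /le_trans; apply; rewrite ge_min lexx.
Qed.

(** * Values of the penalty function *)

Lemma einner_ge0 (R : realType) (m : nat) (t : 'rV[R]_m) y :
  orthant t -> (forall v, y = Some v -> orthant v) -> (0 <= einner t y)%E.
Proof.
case: y => [v|] t0 v0; last by rewrite /= le0y.
rewrite /= lee_fin sumr_ge0// => i _.
by rewrite mulr_ge0//; exact: v0.
Qed.

Lemma le_einner (R : realType) (m : nat) (t t' : 'rV[R]_m) y :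
  orthant (t' - t) -> (forall v, y = Some v -> orthant v) ->
  (einner t y <= einner t' y)%E.
Proof.
case: y => [v|] t0 v0; last by [].
rewrite /= lee_fin ler_sum// => i _; rewrite ler_wpM2r//; first exact: v0.
by have := t0 i; rewrite !mxE subr_ge0.
Qed.

Lemma penalty_proper (R : realType) (m : nat) (X : Type) (f : X -> \bar R)
    (phi : X -> option 'rV[R]_m) (t : 'rV[R]_m) (y : X) :
  (-oo < f y)%E -> (penalty_fun f phi t y < +oo)%E ->
  f y \is a fin_num /\ exists v, phi y = Some v.
Proof.
rewrite /penalty_fun; case: (f y) => [r| |]//; case: (phi y) => [v|]//= _ _.
by split => //; exists v.
Qed.

Lemma penalty_feasible (R : realType) (m : nat) (X : Type) (f : X -> \bar R)
    (phi : X -> option 'rV[R]_m) (t : 'rV[R]_m) (y : X) :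
  phi y = Some 0 -> penalty_fun f phi t y = f y.
Proof.
rewrite /penalty_fun => ->; rewrite /= big1 ?adde0// => i _.
by rewrite mxE mulr0.
Qed.

Lemma penalty_ge (R : realType) (m : nat) (X : Type) (f : X -> \bar R)
    (phi : X -> option 'rV[R]_m) (t : 'rV[R]_m) (y : X) :
  (forall x v, phi x = Some v -> orthant v) -> orthant t ->
  (f y <= penalty_fun f phi t y)%E.
Proof. by move=> phiK t0; rewrite leeDl// einner_ge0//; exact: phiK. Qed.

Lemma le_penalty (R : realType) (m : nat) (X : Type) (f : X -> \bar R)
    (phi : X -> option 'rV[R]_m) (t t' : 'rV[R]_m) (y : X) :
  (forall x v, phi x = Some v -> orthant v) -> orthant (t' - t) ->
  (penalty_fun f phi t y <= penalty_fun f phi t' y)%E.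
Proof. by move=> phiK t0; rewrite leeD2l// le_einner//; exact: phiK. Qed.

Lemma lt_inner (R : realType) (m : nat) (t t' v : 'rV[R]_m) :
  pos_orthant (t' - t) -> orthant v -> v != 0 -> inner t v < inner t' v.
Proof.
move=> tt' v0 vn0; rewrite lt_neqAle; apply/andP; split; last first.
  rewrite ler_sum// => i _; rewrite ler_wpM2r//.
  by have := tt' i; rewrite !mxE subr_gt0 => /ltW.
apply: contra_neq vn0 => /eqP; rewrite eq_sym -subr_eq0 /inner -sumrB.
rewrite psumr_eq0 => [/allP h|i _]; last first.
  rewrite -mulrBl mulr_ge0//.
  by have := tt' i; rewrite !mxE => /ltW.
apply/rowP => i; rewrite [RHS]mxE.
have := h i (mem_index_enum _); rewrite -mulrBl mulf_eq0 => /orP[|/eqP//].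
by have := tt' i; rewrite !mxE => /gt_eqF ->.
Qed.

Lemma lt_penalty (R : realType) (m : nat) (X : Type) (f : X -> \bar R)
    (phi : X -> option 'rV[R]_m) (t t' : 'rV[R]_m) (y : X) :
  (forall x v, phi x = Some v -> orthant v) -> pos_orthant (t' - t) ->
  phi y <> Some 0 -> (-oo < f y)%E -> (penalty_fun f phi t y < +oo)%E ->
  (penalty_fun f phi t y < penalty_fun f phi t' y)%E.
Proof.
move=> phiK tt' phiy fy /(penalty_proper fy)[ffin [v yv]].
rewrite /penalty_fun lteD2lE// yv /= lte_fin; apply: lt_inner => //.
  exact: phiK yv.
by apply/eqP => v0; apply: phiy; rewrite yv v0.
Qed.

(** * Optimal solutions of the constrained and of the penalized problem *)

Lemma solution_value_fin_num (R : realType) (X : Type) (F : X -> \bar R)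
    (A : set X) p :
  global_solutions F A p -> ereal_inf (F @` A) \is a fin_num ->
  F p \is a fin_num.
Proof.
move=> [Ap pmin]; suff -> : ereal_inf (F @` A) = F p by [].
apply/eqP; rewrite eq_le; apply/andP; split.
  by apply: ereal_inf_lbound; exists p.
by apply: le_ereal_inf_tmp => _ [y Ay <-]; exact: pmin.
Qed.

Lemma solution_penalty_le (R : realType) (m : nat) (X : Type) (f : X -> \bar R)
    (phi : X -> option 'rV[R]_m) (M Q : set X) t p z :
  (forall x, phi x = Some 0 <-> M x) ->
  global_solutions f (M `&` Q) p ->
  global_solutions (penalty_fun f phi t) Q z ->
  (penalty_fun f phi t z <= f p)%E.
Proof.
move=> phi0 [[Mp Qp] _] [_ /(_ p Qp)].
by rewrite (penalty_feasible _ t (y := p))//; exact/phi0.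
Qed.

(** At an infeasible point with finite penalized value, raising every multiplier
    strictly raises the penalized value ([lt_penalty]). So the lower bound
    [f p], which may be attained off the feasible set at [taus], no longer is at
    a strictly larger parameter, and all penalized minimizers are feasible. *)
Lemma exact_above (R : realType) (m : nat) (X : Type) (f : X -> \bar R)
    (phi : X -> option 'rV[R]_m) (M Q : set X) (taus t : 'rV[R]_m) p :
  (forall x v, phi x = Some v -> orthant v) ->
  (forall x, phi x = Some 0 <-> M x) ->
  (forall x, (-oo < f x)%E) ->
  global_solutions f (M `&` Q) p -> f p \is a fin_num ->
  orthant taus ->
  (forall y, Q y -> (f p <= penalty_fun f phi taus y)%E) ->
  pos_orthant (t - taus) -> exact_penalty_parameter f phi M Q t.
Proof.
move=> phiK phi0 fNy solp fpfin taus0 lb tpos; split.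
  move=> i; have := tpos i; rewrite !mxE subr_gt0; apply: le_lt_trans.
  exact: taus0.
move=> t' t'pos t't.
have ltt : pos_orthant (t' - taus).
  move=> i; have := t't i; have := tpos i; rewrite !mxE; lra.
have ltt0 : orthant (t' - taus) by move=> i; exact/ltW/ltt.
have feas z : M z -> penalty_fun f phi t' z = f z.
  by move=> /phi0 ?; exact: penalty_feasible.
case: (solp) => [[Mp Qp] pmin].
apply/seteqP; split => [z [[Mz Qz] zmin]|z [Qz zmin]].
  split => // y Qy; rewrite (feas _ Mz) (le_trans (zmin _ (conj Mp Qp)))//.
  by rewrite (le_trans (lb y Qy))// le_penalty.
have zp : (penalty_fun f phi t' z <= f p)%E.
  by rewrite -(feas _ Mp); exact: zmin.
suff Mz : M z.
  split => // y [My Qy]; rewrite -(feas _ Mz) (le_trans zp)//.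
  exact: pmin.
apply: contrapT => nMz.
have := lb z Qz; apply/negP; rewrite -ltNge; apply: lt_le_trans zp.
apply: lt_penalty => //; first by move=> /phi0.
apply: le_lt_trans (le_penalty f z phiK ltt0) _.
rewrite (le_lt_trans (zmin _ Qp))// (feas _ Mp).
by rewrite ltey_eq fpfin.
Qed.

(** * Limit points *)

Lemma seq_limit_point_frequently (X : topologicalType) (u : nat -> X) p
    (V : set X) (P : nat -> Prop) :
  seq_limit_point u p -> nbhs p V -> (\forall n \near \oo, P n) ->
  exists2 n, V (u n) & P n.
Proof.
move=> [g ginc gp] Vp P_oo.
have gk k : (k <= g k)%N.
  elim: k => // k ih; apply: leq_ltn_trans ih _.
  by have /increasing_seqP := ginc; exact.
have [k0 _ hP] := P_oo.
have [k1 _ hV] := gp _ Vp.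
exists (g (maxn k0 k1)).
  by apply: hV => /=; exact: leq_maxr.
by apply: hP => /=; exact: leq_trans (leq_maxl _ _) (gk _).
Qed.

Lemma seq_limit_point_closed (X : topologicalType) (Q : set X)
    (u : nat -> X) p :
  closed Q -> (forall n, Q (u n)) -> seq_limit_point u p -> Q p.
Proof.
move=> cQ Qu [g _ gp]; apply: (closed_cvg _ cQ _ _ gp).
by apply: nearW => k; exact: Qu.
Qed.

(** Stated for an upper bound [b] rather than for a lower limit: each use
    compares the value at a limit point with a fixed bound for the values along
    the sequence. *)
Lemma seq_limit_point_lsc (R : realType) (X : topologicalType) (Q : set X)
    (F : X -> \bar R) (u : nat -> X) p (b : \bar R) :
  lower_semicontinuous_on Q F -> (forall n, Q (u n)) -> Q p ->
  seq_limit_point u p -> (\forall n \near \oo, (F (u n) <= b)%E) ->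
  (F p <= b)%E.
Proof.
move=> lF Qu Qp up Fb.
have H (a : R) : (b <= a%:E)%E -> (F p <= a%:E)%E.
  move=> ba; rewrite leNgt; apply/negP => aF.
  have [V pV aV] := lF p a aF.
  move: pV; rewrite /nbhs/= -nbhs_subspace_in// => pV.
  have [n Vn Fn] := seq_limit_point_frequently up pV Fb.
  have := aV _ (Vn (Qu n)); apply/negP; rewrite -leNgt.
  exact: le_trans Fn ba.
case: b Fb H => [b| |] Fb H; last 1 first.
- case: (F p) H => [r| |]// H.
    have : (r%:E <= (r - 1)%:E)%E by apply: H; exact: leNye.
    by rewrite lee_fin => h; exfalso; lra.
  by have : (+oo <= 0%:E :> \bar R)%E by apply: H; exact: leNye.
- exact: H.
- exact: leey.
Qed.

(** * Multipliers along an infinite run *)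

Lemma innerBl (R : realType) (m : nat) (t t' v : 'rV[R]_m) :
  inner (t - t') v = inner t v - inner t' v.
Proof.
by rewrite /inner -sumrB; apply: eq_bigr => i _; rewrite !mxE mulrBl.
Qed.

Lemma bounded_nondecreasing_cvg (R : realType) (m : nat) (N : 'rV[R]_m -> R)
    (tau : nat -> 'rV[R]_m) (B : R) :
  is_norm N -> (forall n, orthant (tau n.+1 - tau n)) ->
  (forall n, N (tau n) <= B) ->
  exists2 taus : 'rV[R]_m, forall n, orthant (taus - tau n) &
    N (tau n - taus) @[n --> \oo] --> (0 : R).
Proof.
move=> nN tauS tauB; have [C hC] := coord_le_norm nN.
have nd i : nondecreasing_seq (fun n => tau n ord0 i).
  by apply/nondecreasing_seqP => n; have := tauS n i; rewrite !mxE subr_ge0.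
have cv i : cvgn (fun n => tau n ord0 i).
  apply: nondecreasing_is_cvgn => //; exists (`|C| * B) => _ [n _ <-].
  apply: le_trans (ler_norm _) _; apply: le_trans (hC _ _) _.
  apply: le_trans (ler_wpM2r (is_norm_ge0 _ nN) (ler_norm C)) _.
  exact: ler_wpM2l.
exists (\row_i limn (fun n => tau n ord0 i)).
  move=> n i; rewrite !mxE subr_ge0.
  exact: (nondecreasing_cvgn_le (nd i) (cv i)).
by apply: norm_cvg_coord => // i; rewrite mxE; exact: cv.
Qed.

(** Optimality of the first iterate bounds the penalty function for [tau 0] from
    below, although [f] itself may be unbounded below; [f] cancels in the
    difference of the penalty functions for [tau n] and [tau 0]. *)
Lemma penalty_increment_bounded (R : realType) (m : nat) (X : Type)
    (f : X -> \bar R) (phi : X -> option 'rV[R]_m) (Q : set X) (x : nat -> X)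
    (tau v : nat -> 'rV[R]_m) (F : R) :
  (forall n, f (x n) \is a fin_num) -> (forall n, phi (x n) = Some (v n)) ->
  (forall n, Q (x n)) ->
  global_solutions (penalty_fun f phi (tau 0%N)) Q (x 0%N) ->
  (forall n, (penalty_fun f phi (tau n) (x n) <= F%:E)%E) ->
  exists C, forall n, inner (tau n - tau 0%N) (v n) <= C.
Proof.
move=> ffin phiv Qx [_ x0min] xF.
exists (F - (fine (f (x 0%N)) + inner (tau 0%N) (v 0%N))) => n.
have := xF n; have := x0min _ (Qx n).
rewrite /penalty_fun !phiv -(fineK (ffin n)) -(fineK (ffin 0%N)) /= !lee_fin.
rewrite innerBl -![\sum_(i < m) _]/(inner _ _); lra.
Qed.

(** * The adaptive penalty method *)

Theorem theorem4 (R : realType) (X : metricType R) (m : nat)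
    (N : 'rV[R]_m -> R) (normN : is_norm N)
    (M Q : set X) (MQ0 : M `&` Q !=set0)
    (f : X -> \bar R) (f_gtNy : forall x, (-oo < f x)%E)
    (P_solvable : global_solutions f (M `&` Q) !=set0)
    (P_finite : ereal_inf (f @` (M `&` Q)) \is a fin_num)
    (phi : X -> option 'rV[R]_m)
    (phiK : forall x v, phi x = Some v -> orthant v)
    (phi0 : forall x, phi x = Some 0 <-> M x)
    (closedQ : closed Q)
    (lsc_f : lower_semicontinuous_on Q f)
    (lsc_phi : lower_semicontinuous_on Q (fun x => enorm N (phi x)))
    (x : nat -> X) (tau : nat -> 'rV[R]_m) (s : nat -> R)
    (run : adaptive_run f phi M Q x tau s)
    (scaling : exists2 gamma : R, 0 < gamma &
      (forall n, reached (M `&` Q) x n.+1 -> gamma <= s n) \/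
      (forall n, reached (M `&` Q) x n.+1 ->
        (gamma%:E / enorm N (phi (x n)) <= (s n)%:E)%E)) :
  (exists n, [/\ reached (M `&` Q) x n, (M `&` Q) (x n) &
     global_solutions f (M `&` Q) (x n)]) \/
  [/\ forall n, ~ (M `&` Q) (x n),
      enorm N (phi (x n)) @[n --> \oo] --> 0%E,
      forall p, seq_limit_point x p -> global_solutions f (M `&` Q) p &
      (exists B : R, forall n, N (tau n) <= B) ->
      (exists p, seq_limit_point x p) ->
      globally_exact f phi M Q /\
      exists2 taus : 'rV[R]_m,
        N (tau n - taus) @[n --> \oo] --> (0 : R) &
        forall t, pos_orthant (t - taus) ->
          exact_penalty_parameter f phi M Q t].
Proof.
have [p solp] := P_solvable.
have fpfin := solution_value_fin_num solp P_finite.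
have fpy : (f p < +oo)%E by rewrite ltey_eq fpfin.
have [Mp pmin] := solp.
have xle n : reached (M `&` Q) x n ->
    (penalty_fun f phi (tau n) (x n) <= f p)%E.
  by move=> /(run_solution run); exact: solution_penalty_le.
have [[n xn]|infeasible] := pselect (exists n, (M `&` Q) (x n)).
  left.
  (* The method stops at the first feasible iterate, so take the least index. *)
  have exn : exists n, `[< (M `&` Q) (x n) >] by exists n; exact/asboolP.
  case: (ex_minnP exn) => k /asboolP xk kmin.
  have rk : reached (M `&` Q) x k.
    by move=> j jk xj; have := kmin j (asboolT xj); rewrite leqNgt jk.
  exists k; do 2!split => //; move=> y Ay.
  apply: le_trans (pmin y Ay); have := xle k rk.
  by rewrite (penalty_feasible _ _ (y := x k))//; apply/phi0; case: xk.
right.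
have rch n : reached (M `&` Q) x n.
  by move=> k _ xk; apply: infeasible; exists k.
have solx n := run_solution run (rch n).
have Qx n : Q (x n) by have [] := solx n.
have prop n := penalty_proper (f_gtNy (x n)) (le_lt_trans (xle n (rch n)) fpy).
have ffin n : f (x n) \is a fin_num by have [] := prop n.
have [v phiv] : exists v, forall n, phi (x n) = Some (v n).
  exists (fun n => odflt 0 (phi (x n))) => n.
  by have [_ [w ->]] := prop n.
have v0 n : orthant (v n) by exact: phiK (phiv n).
have Nv0 n : 0 < N (v n).
  rewrite lt_neqAle is_norm_ge0// andbT eq_sym; apply/eqP.
  move=> /(norm_definite normN) vn0; apply: infeasible; exists n.
  by split => //; apply/phi0; rewrite phiv vn0.
have s0 n : 0 <= s n by exact/ltW/(run_scale run).
have tauS n : tau n.+1 = tau n + s n *: v n.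
  by have := run_update run (rch n.+1); rewrite phiv => -[].
have tauS0 n : orthant (tau n.+1 - tau n).
  by move=> i; rewrite tauS addrAC subrr add0r mxE mulr_ge0//; exact: v0.
have tau0 n : orthant (tau n).
  elim: n => [i|n ih i]; first exact/ltW/(run_init run).
  by have := tauS0 n i; rewrite !mxE subr_ge0; apply: le_trans; exact: ih.
have fle n : (f (x n) <= f p)%E.
  by apply: le_trans (xle n (rch n)); exact: penalty_ge.
have vN : N (v n) @[n --> \oo] --> (0 : R).
  have [gamma gamma0 sg] := scaling.
  have [C hC] : exists C, forall n, inner (tau n - tau 0%N) (v n) <= C.
    apply: (@penalty_increment_bounded _ _ _ f phi Q x _ _ (fine (f p))) => //.
    by move=> n; rewrite fineK//; exact: xle.
  apply: (adaptive_norm_vanish (s := s) (tau := tau) (C := C)) gamma0 _ _ _ _ _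
    => // n.
  (* Both step rules give the bound with weight max 1 (N (v n)). *)
  case: sg => sg.
    by rewrite (le_trans (sg n (rch _)))// ler_peMr// le_max lexx.
  have := sg n (rch _); rewrite phiv /= inver gt_eqF// -EFinM lee_fin.
  rewrite ler_pdivrMr// => /le_trans; apply.
  by rewrite ler_wpM2l// le_max lexx orbT.
have limit_feasible q : seq_limit_point x q -> Q q -> M q.
  move=> xq Qq.
  have : (enorm N (phi q) <= 0)%E.
    apply/lee_addgt0Pr => e e0; rewrite add0e.
    apply: (seq_limit_point_lsc lsc_phi Qx Qq xq).
    apply: filterS (cvgr_le 0 vN _ e0) => n.
    by rewrite phiv /= lee_fin.
  case E : (phi q) => [w|]; last by rewrite /= leye_eq.
  rewrite /= lee_fin => Nw; apply/phi0; rewrite E; congr Some.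
  apply: (norm_definite normN); apply/eqP.
  by rewrite eq_le Nw is_norm_ge0.
have limit_solution q : seq_limit_point x q -> global_solutions f (M `&` Q) q.
  move=> xq; have Qq := seq_limit_point_closed closedQ Qx xq.
  split; first by split => //; exact: limit_feasible.
  move=> y Ay; apply: le_trans (pmin y Ay).
  by apply: (seq_limit_point_lsc lsc_f Qx Qq xq); exact: nearW.
split => //.
- by move=> n xn; apply: infeasible; exists n.
- under eq_fun do rewrite phiv /=.
  by apply: cvg_EFin; [exact: nearW|exact: vN].
- move=> [B tauB] [q xq].
  have [taus taus_ge taus_cvg] := bounded_nondecreasing_cvg normN tauS0 tauB.
  have taus0 : orthant taus.
    by move=> i; have := taus_ge 0%N i; have := tau0 0%N i; rewrite !mxE; lra.
  have [[Mq Qq] qmin] := limit_solution q xq.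
  have exact_gt t : pos_orthant (t - taus) ->
      exact_penalty_parameter f phi M Q t.
    apply: (exact_above phiK phi0 f_gtNy solp fpfin taus0) => y Qy.
    apply: (le_trans (pmin _ (conj Mq Qq))).
    (* f (x n) <= Phi_(tau n) (x n) <= Phi_(tau n) y <= Phi_taus y. *)
    apply: (seq_limit_point_lsc lsc_f Qx Qq xq); apply: nearW => n.
    have [_ /(_ y Qy) xny] := solx n.
    apply: le_trans (le_penalty f y phiK (taus_ge n)).
    by apply: le_trans xny; exact: penalty_ge.
  split; last by exists taus.
  exists (taus + const_mx 1); apply: exact_gt => i.
  by rewrite addrAC subrr add0r mxE.
Qed.
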